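(* Let $K\subset\mathbb{R}^d$ be a convex body and $r>0$. Then for any affine contraction $T:\mathbb{R}^d\to\mathbb{R}^d$, $$\mathrm{Vol}(T(K)+rB)\le\mathrm{Vol}(K+rB),$$ where $B$ is the open Euclidean unit ball of $\mathbb{R}^d$ centered at the origin.
   Context: An affine contraction is a map $T(x)=Ax+b$ with $A$ linear and $b\in\mathbb{R}^d$ fixed, that is $1$-Lipschitz for the Euclidean norm. $\mathrm{Vol}$ is Lebesgue measure on $\mathbb{R}^d$, and sums of sets are Minkowski sums. *)

(* Defs.v *)
From HB Require Import structures.
From mathcomp Require Import all_boot all_order all_algebra.
From mathcomp Require Import all_classical all_reals all_analysis.

Set Implicit Arguments.
Unset Strict Implicit.
Unset Printing Implicit Defensive.

Import Order.TTheory GRing.Theory Num.Theory.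
Import numFieldNormedType.Exports.

Local Open Scope classical_set_scope.
Local Open Scope ring_scope.

Section lebesgue_tuple.
Local Open Scope ereal_scope.
Context {R : realType}.
Local Notation RR := (measurableTypeR R).

Definition cons_pair n (p : RR * n.-tuple RR) : n.+1.-tuple RR :=
  [tuple of p.1 :: p.2].

Definition split_tuple n (t : n.+1.-tuple RR) : RR * n.-tuple RR :=
  (thead t, [tuple of behead t]).

(* For n = 0 this is the unit mass on the only point; otherwise it is the image
   of the product measure under (x, t) |-> x :: t.  The instances below make it
   a sigma-finite measure on the product sigma-algebra. *)
Fixpoint lebesgue_tuple n : set (n.-tuple RR) -> \bar R :=
  if n is n'.+1 then
    pushforward (lebesgue_measure \x @lebesgue_tuple n') (@cons_pair n')
  else \d_ [tuple].

Lemma measurable_cons_pair n : measurable_fun [set: _] (@cons_pair n).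
Proof. exact: measurable_cons. Qed.

Lemma measurable_split_tuple n : measurable_fun [set: _] (@split_tuple n).
Proof.
apply: measurable_fun_pair; last exact: measurable_behead.
exact: measurable_tnth.
Qed.

Lemma cons_pairK n : cancel (@cons_pair n) (@split_tuple n).
Proof. by case=> x t; rewrite /split_tuple theadE; congr pair; apply/val_inj. Qed.

Lemma split_tupleK n : cancel (@split_tuple n) (@cons_pair n).
Proof. by move=> t; rewrite /cons_pair -tuple_eta. Qed.

Section lebesgue_cons.
Context n (mu : {sigma_finite_measure set (n.-tuple RR) -> \bar R}).

Definition lebesgue_cons :=
  pushforward (lebesgue_measure \x mu) (@cons_pair n).

Let lebesgue_cons0 : lebesgue_cons set0 = 0.
Proof. by rewrite /lebesgue_cons /pushforward preimage_set0 measure0. Qed.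

Let lebesgue_cons_ge0 A : 0 <= lebesgue_cons A.
Proof. by rewrite /lebesgue_cons /pushforward measure_ge0. Qed.

Let lebesgue_cons_sigma_additive : semi_sigma_additive lebesgue_cons.
Proof.
move=> F mF tF mUF; rewrite /lebesgue_cons /pushforward preimage_bigcup.
apply: measure_semi_sigma_additive.
- by move=> k; rewrite -[X in measurable X]setTI; exact: measurable_cons_pair.
- apply/trivIsetP => /= i j _ _ ij; rewrite -preimage_setI.
  by move/trivIsetP : tF => /(_ _ _ _ _ ij) ->//; rewrite preimage_set0.
- rewrite -preimage_bigcup -[X in measurable X]setTI.
  exact: measurable_cons_pair.
Qed.

HB.instance Definition _ := isMeasure.Build _ _ _ lebesgue_cons
  lebesgue_cons0 lebesgue_cons_ge0 lebesgue_cons_sigma_additive.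

Let lebesgue_cons_sigma_finite : sigma_finite setT lebesgue_cons.
Proof.
have /sigma_finiteP[F [TF ndF Foo]] := sigma_finiteT (@lebesgue_measure R).
have /sigma_finiteP[G [TG ndG Goo]] := sigma_finiteT mu.
exists (fun k => @split_tuple n @^-1` (F k `*` G k)).
  rewrite -preimage_bigcup; apply/esym/seteqP; split=> // t _ /=.
  have [i _ Fi] : (\bigcup_i F i) (split_tuple t).1 by rewrite -TF.
  have [j _ Gj] : (\bigcup_i G i) (split_tuple t).2 by rewrite -TG.
  exists (maxn i j) => //; split.
    by move: Fi; apply/subsetPset/ndF/leq_maxl.
  by move: Gj; apply/subsetPset/ndG/leq_maxr.
move=> k; have [mF Fk] := Foo k; have [mG Gk] := Goo k; split.
  rewrite -[X in measurable X]setTI; apply: measurable_split_tuple => //.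
  exact: measurableX.
rewrite /lebesgue_cons /pushforward (_ : _ @^-1` _ = F k `*` G k).
  by rewrite product_measure1E// lte_mul_pinfty// ge0_fin_numE.
by apply/funext => p; rewrite /preimage /mkset cons_pairK.
Qed.

HB.instance Definition _ :=
  Measure_isSigmaFinite.Build _ _ _ lebesgue_cons lebesgue_cons_sigma_finite.

End lebesgue_cons.

Lemma lebesgue_tuple_measureP n :
  exists mu : {sigma_finite_measure set (n.-tuple RR) -> \bar R},
    @lebesgue_tuple n = mu.
Proof.
elim: n => [|n [mu IH]] /=; first by exists (\d_ ([tuple] : 0.-tuple RR)).
by exists (lebesgue_cons mu); rewrite IH.
Qed.

Let lebesgue_tuple0 n : @lebesgue_tuple n set0 = 0.
Proof. by have [mu ->] := lebesgue_tuple_measureP n; rewrite measure0. Qed.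

Let lebesgue_tuple_ge0 n A : 0 <= @lebesgue_tuple n A.
Proof. by have [mu ->] := lebesgue_tuple_measureP n. Qed.

Let lebesgue_tuple_sigma_additive n : semi_sigma_additive (@lebesgue_tuple n).
Proof.
by have [mu ->] := lebesgue_tuple_measureP n; exact: measure_semi_sigma_additive.
Qed.

HB.instance Definition _ n := isMeasure.Build _ _ _ (@lebesgue_tuple n)
  (@lebesgue_tuple0 n) (@lebesgue_tuple_ge0 n)
  (@lebesgue_tuple_sigma_additive n).

Let lebesgue_tuple_sigma_finite n : sigma_finite setT (@lebesgue_tuple n).
Proof. by have [mu ->] := lebesgue_tuple_measureP n; exact: sigma_finiteT. Qed.

HB.instance Definition _ n := Measure_isSigmaFinite.Build _ _ _
  (@lebesgue_tuple n) (@lebesgue_tuple_sigma_finite n).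

Lemma measurable_box n (A : 'I_n -> set RR) : (forall i, measurable (A i)) ->
  measurable [set t : n.-tuple RR | forall i, A i (tnth t i)].
Proof.
move=> mA.
rewrite (_ : [set _ | _] = \bigcap_(i in [set: 'I_n]) (tnth (T:=RR))^~ i @^-1` A i).
  apply: fin_bigcap_measurable => // i _; rewrite -[X in measurable X]setTI.
  exact: measurable_tnth.
by apply/seteqP; split=> t /= tA i; [move=> _; exact: tA|exact: tA].
Qed.

Lemma lebesgue_tuple_box n (A : 'I_n -> set RR) :
  (forall i, measurable (A i)) ->
  lebesgue_tuple [set t : n.-tuple RR | forall i, A i (tnth t i)] =
  \prod_(i < n) lebesgue_measure (A i).
Proof.
elim: n => [|n IH] in A * => mA.
  rewrite big_ord0 /= diracE mem_set//=; by case.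
rewrite big_ord_recl -IH//= -product_measure1E//; last first.
  by apply: (@measurable_box n (fun i => A (lift ord0 i))) => i; exact: mA.
rewrite /pushforward; congr (product_measure1 _ _ _).
apply/seteqP; split=> [[x t]|[x t]] /=.
  move=> h; split=> [|i]; first exact: (h ord0).
  by have := h (lift ord0 i); rewrite tnthS.
move=> [Ax At] i; case: (unliftP ord0 i) => [j|] ->//.
by rewrite tnthS; exact: At.
Qed.

End lebesgue_tuple.

Section euclidean.
Context {R : realType} {d : nat}.
Implicit Types (A K : set 'rV[R]_d) (x : 'rV[R]_d).

(* The library norm of 'rV[R]_d is the sup norm; it induces the same topology,
   hence the same compact sets, as the Euclidean norm. *)
Definition enorm x : R := Num.sqrt (\sum_(i < d) x ord0 i ^+ 2).

Definition unit_ball : set 'rV[R]_d := [set x | enorm x < 1].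

Definition minkowski_sum A B : set 'rV[R]_d := [set x + y | x in A & y in B].

Definition dilate (r : R) A : set 'rV[R]_d := [set r *: x | x in A].

(* Lebesgue measure of Borel sets of 'rV[R]_d, identified with d.-tuple R; off
   the Borel sets the value is that of an iterated integral and has no meaning.
   A set of the form minkowski_sum A (dilate r unit_ball) with r > 0 is open,
   hence Borel, whatever A is. *)
Definition Vol A : \bar R :=
  lebesgue_tuple [set t : d.-tuple (measurableTypeR R) |
    A (\row_(i < d) (tnth t i : R))].

Lemma Vol_box (A : 'I_d -> set (measurableTypeR R)) :
  (forall i, measurable (A i)) ->
  Vol [set x | forall i, A i (x ord0 i)] =
  (\prod_(i < d) lebesgue_measure (A i))%E.
Proof.
move=> mA; rewrite -lebesgue_tuple_box//; congr lebesgue_tuple.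
by apply/seteqP; split=> t /= tA i; have := tA i; rewrite mxE.
Qed.

(* A nonempty interior is not required. *)
Definition convex_body K :=
  [/\ K !=set0, compact K & convex_set (K : set (convex_lmodType 'rV[R]_d))].

Definition affine_contraction (T : 'rV[R]_d -> 'rV[R]_d) :=
  (exists (A : {linear 'rV[R]_d -> 'rV[R]_d}) (b : 'rV[R]_d),
     forall x, T x = A x + b) /\
  (forall x y, enorm (T x - T y) <= enorm (x - y)).

End euclidean.

(* Main.v *)
(* A contraction matrix is a product of maps x - c <x,u> u with 0 <= c and
   c |u|^2 <= 2 (reflections and partial projections): a unit vector v
   maximising |Av| on the orthogonal complement of the fixed space of A has
   A v = s w and A^T w = s v, so one such factor turns s into 1, a reflection
   brings w back to v, and the fixed space has grown.  For a single factor, each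
   line parallel to u meets K + rB in an interval, because K is convex, and meets
   the compressed set in a set of no larger diameter, so Cavalieri's principle
   along u compares the volumes. *)

Require Import Defs.
From mathcomp Require Import all_boot all_order all_algebra.
From mathcomp Require Import all_classical all_reals all_analysis measurable_realfun.
From mathcomp Require Import zify ring lra.

Import Order.TTheory GRing.Theory Num.Theory.
Import numFieldNormedType.Exports.

Local Open Scope classical_set_scope.
Local Open Scope ring_scope.

(** * Lebesgue measure on row vectors *)

Definition row_of {R : realType} {n} (t : n.-tuple (measurableTypeR R)) :
  'rV[R]_n := \row_(i < n) (tnth t i : R).

(* Borel sets of 'rV[R]_n, through the identification used by Vol. *)
Definition borel_row {R : realType} {n} (A : set 'rV[R]_n) :=
  measurable (@row_of R n @^-1` A).

(** The counterpart of [cons_pair] on row vectors, for inductions on the dimension. *)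
Definition consv {R : realType} {n} (x : R) (y : 'rV[R]_n) : 'rV[R]_n.+1 :=
  row_mx (const_mx x : 'rV[R]_1) y.

Section row_vectors.
Context {R : realType}.
Local Notation RR := (measurableTypeR R).

Lemma consv0 n (x : R) (y : 'rV[R]_n) : consv x y 0 0 = x.
Proof.
transitivity (row_mx (const_mx x : 'rV_1) y 0 (lshift n 0)).
  by congr (row_mx _ _ _ _); exact: val_inj.
by rewrite row_mxEl mxE.
Qed.

Lemma consvS n (x : R) (y : 'rV[R]_n) i : consv x y 0 (lift ord0 i) = y 0 i.
Proof.
rewrite -(row_mxEr (const_mx x : 'rV_1) y 0 i).
by congr (row_mx _ _ _ _); apply: ord_inj => /=.
Qed.

Lemma consv_eta n (v : 'rV[R]_n.+1) : v = consv (v 0 0) (rsubmx (v : 'rV_(1 + n))).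
Proof.
apply/rowP => i; case: (unliftP ord0 i) => [j|] ->; last by rewrite consv0.
by rewrite consvS mxE; congr (v _ _); apply/val_inj.
Qed.

Lemma consvD n (a b : R) (x y : 'rV[R]_n) :
  consv a x + consv b y = consv (a + b) (x + y).
Proof.
apply/rowP => i; case: (unliftP ord0 i) => [j|] ->.
  by rewrite mxE !consvS mxE.
by rewrite mxE !consv0.
Qed.

Lemma consvZ n (k a : R) (x : 'rV[R]_n) :
  k *: consv a x = consv (k * a) (k *: x).
Proof.
apply/rowP => i; case: (unliftP ord0 i) => [j|] ->.
  by rewrite mxE !consvS mxE.
by rewrite mxE !consv0.
Qed.

Lemma row_of_cons n (x : RR) (t : n.-tuple RR) :
  row_of [tuple of x :: t] = consv x (row_of t).
Proof.
apply/rowP => i; case: (unliftP ord0 i) => [j|] ->.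
  by rewrite mxE consvS mxE tnthS.
by rewrite mxE consv0 tnth0.
Qed.

Lemma borel_row_preimage n m (f : 'rV[R]_n -> 'rV[R]_m) (A : set 'rV[R]_m) :
    (forall j, measurable_fun [set: n.-tuple RR]
       (fun t => f (row_of t) 0 j : RR)) ->
  borel_row A -> borel_row (f @^-1` A).
Proof.
move=> mf mA.
pose g (t : n.-tuple RR) : m.-tuple RR := [tuple (f (row_of t) 0 j : RR) | j < m].
have mg : measurable_fun setT g.
  apply/measurable_fun_tnthP => j; apply: eq_measurable_fun (mf j) => t _ /=.
  by rewrite tnth_mktuple.
rewrite /borel_row (_ : _ @^-1` _ = g @^-1` (@row_of R m @^-1` A)).
  by rewrite -[X in measurable X]setTI; exact: mg.
apply/seteqP; split => t /=; rewrite /preimage/= (_ : row_of (g t) = f (row_of t))//.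
  by apply/rowP => j; rewrite mxE tnth_mktuple.
by apply/rowP => j; rewrite mxE tnth_mktuple.
Qed.

Lemma measurable_row_of n (j : 'I_n) :
  measurable_fun [set: n.-tuple RR] (fun t => row_of t 0 j : RR).
Proof.
apply: eq_measurable_fun (@measurable_tnth _ RR n j) => t _ /=.
by rewrite mxE.
Qed.

Lemma borel_row_translate n (v : 'rV[R]_n) (A : set 'rV[R]_n) :
  borel_row A -> borel_row [set x | A (x + v)].
Proof.
apply: (@borel_row_preimage _ _ (fun x => x + v)) => j.
apply: (@eq_measurable_fun _ _ _ _ _ (fun t => row_of t 0 j + v 0 j : RR)).
  by move=> t _; rewrite [RHS]mxE.
by apply: measurable_funD => //; exact: measurable_row_of.
Qed.

Lemma borel_row_shear n (w : 'rV[R]_n.+1) (A : set 'rV[R]_n.+1) :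
  borel_row A -> borel_row [set x : 'rV[R]_n.+1 | A (x + x 0 0 *: w)].
Proof.
apply: (@borel_row_preimage _ _ (fun x => x + x 0 0 *: w)) => j.
apply: (@eq_measurable_fun _ _ _ _ _
  (fun t => row_of t 0 j + row_of t 0 0 * w 0 j : RR)).
  by move=> t _; rewrite [RHS]mxE; congr (_ + _); rewrite [RHS]mxE.
apply: measurable_funD; first exact: measurable_row_of.
by apply: measurable_funM => //; exact: measurable_row_of.
Qed.

Lemma borel_row_consl n (x : R) (A : set 'rV[R]_n.+1) :
  borel_row A -> borel_row [set y | A (consv x y)].
Proof.
apply: (@borel_row_preimage _ _ (consv x)) => j.
case: (unliftP ord0 j) => [i|] ->.
  apply: (@eq_measurable_fun _ _ _ _ _ (fun t => row_of t 0 i : RR)).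
    by move=> t _; rewrite consvS.
  exact: measurable_row_of.
apply: (@eq_measurable_fun _ _ _ _ _ (fun t => x : RR)) => //.
by move=> t _; rewrite consv0.
Qed.

Lemma measurable_cons_pair_row n (A : set 'rV[R]_n.+1) : borel_row A ->
  measurable [set p : RR * n.-tuple RR | A (consv p.1 (row_of p.2))].
Proof.
move=> mA; rewrite (_ : [set p | _] = @cons_pair R n @^-1` (@row_of R n.+1 @^-1` A)).
  by rewrite -[X in measurable X]setTI; apply: measurable_cons_pair.
by apply/seteqP; split => -[x t] /=; rewrite /preimage/= row_of_cons.
Qed.

(** * Fubini, translation invariance and Cavalieri's principle *)

Section fubini.
Local Open Scope ereal_scope.

(** This order of integration is the definition of the product measure, so it holds for every set;
    the opposite order in [Vol_cons_swap] is Tonelli's theorem. *)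
Lemma Vol_cons n (A : set 'rV[R]_n.+1) :
  Vol A = \int[lebesgue_measure]_(x in [set: RR]) Vol [set y | A (consv x y)].
Proof.
rewrite [LHS]/Vol/= /pushforward /product_measure1.
apply: eq_integral => x _ /=; congr (lebesgue_tuple _).
apply/seteqP; split => t; rewrite /xsection/= ?inE/=.
  by rewrite [X in A X](row_of_cons _ _ _).
by move=> At; rewrite [X in A X](row_of_cons _ _ _).
Qed.

Lemma Vol_cons_swap n (A : set 'rV[R]_n.+1) : borel_row A ->
  Vol A = \int[@lebesgue_tuple R n]_t
    lebesgue_measure [set x : RR | A (consv x (row_of t))].
Proof.
move=> mA; rewrite Vol_cons.
have mB := measurable_cons_pair_row _ _ mA.
have := @indic_fubini_tonelli _ _ _ _ R (@lebesgue_measure R)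
  (@lebesgue_tuple R n) _ mB.
rewrite indic_fubini_tonelli_FE// indic_fubini_tonelli_GE// => FG.
transitivity (\int[lebesgue_measure]_x (lebesgue_tuple (n:=n) \o
  xsection [set p : RR * n.-tuple RR | A (consv p.1 (row_of p.2))]) x).
  apply: eq_integral => x _ /=; congr (lebesgue_tuple _).
  by apply/seteqP; split => t; rewrite /xsection/= inE.
rewrite FG; apply: eq_integral => t _ /=; congr (lebesgue_measure _).
by apply/seteqP; split => x; rewrite /ysection/= inE.
Qed.

Lemma measurable_Vol_consl n (A : set 'rV[R]_n.+1) : borel_row A ->
  measurable_fun [set: RR] (fun x => Vol [set y | A (consv x y)]).
Proof.
move=> mA; have mB := measurable_cons_pair_row _ _ mA.
apply: eq_measurable_fun (measurable_fun_xsection (@lebesgue_tuple R n) mB).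
move=> x _ /=; congr (lebesgue_tuple _).
by apply/seteqP; split => t; rewrite /xsection/= inE.
Qed.

Lemma measurable_consr n (t : n.-tuple RR) (A : set 'rV[R]_n.+1) :
  borel_row A -> measurable [set x : RR | A (consv x (row_of t))].
Proof.
move=> mA; have mB := measurable_cons_pair_row _ _ mA.
rewrite (_ : [set x | _] = ysection
  [set p : RR * n.-tuple RR | A (consv p.1 (row_of p.2))] t).
  exact: measurable_ysection.
by apply/seteqP; split => x; rewrite /ysection/= inE.
Qed.

Lemma measurable_lebesgue_consr n (A : set 'rV[R]_n.+1) : borel_row A ->
  measurable_fun [set: n.-tuple RR]
    (fun t => lebesgue_measure [set x : RR | A (consv x (row_of t))]).
Proof.
move=> mA; have mB := measurable_cons_pair_row _ _ mA.
apply: eq_measurable_fun (measurable_fun_ysection (@lebesgue_measure R) mB).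
move=> t _ /=; congr (lebesgue_measure _).
by apply/seteqP; split => x; rewrite /ysection/= inE.
Qed.

Lemma lebesgue_measure_translate (a : R) (A : set RR) : measurable A ->
  lebesgue_measure [set x : RR | A (x + a)%R] = lebesgue_measure A.
Proof.
move=> mA; have mf : measurable_fun [set: RR] (fun x : RR => (x + a)%R : RR).
  exact: measurable_funD.
(* The image of Lebesgue measure under the translation agrees with it on half-open intervals, which
   determine it. *)
apply/esym/(lebesgue_measure_unique
  (mu := pushforward lebesgue_measure (fun x : RR => (x + a)%R : RR))) => //=.
move=> _ [[x y]] _ <-; rewrite /pushforward/=.
rewrite (_ : _ @^-1` _ = `](x - a)%R, (y - a)%R]%classic).
  rewrite !lebesgue_measure_itv/= !lte_fin ltrD2r; case: ifPn => // _.
  by congr EFin; lra.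
by apply/seteqP; split => z /=; rewrite !in_itv/=; lra.
Qed.

(** Induction on the dimension. The translation splits into one of the last [n] coordinates, handled
    slice by slice, and one of the first coordinate, handled after swapping the order of
    integration. *)
Lemma Vol_translate n (v : 'rV[R]_n) (A : set 'rV[R]_n) : borel_row A ->
  Vol [set x | A (x + v)%R] = Vol A.
Proof.
elim: n => [|n IH] in v A *.
  by move=> _; congr Vol; apply/seteqP; split => x/=; rewrite !thinmx0 ?addr0 //;
    rewrite (thinmx0 (x + v)%R) (thinmx0 x).
move=> mA; rewrite (consv_eta _ v); move: (v 0%R 0%R) (rsubmx _) => a w.
pose A' := [set x : 'rV[R]_n.+1 | A (x + consv a 0)%R].
have mA' : borel_row A' by exact: borel_row_translate.
transitivity (Vol A').
  rewrite !Vol_cons; apply: eq_integral => x _ /=.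
  rewrite -[RHS](IH w); last exact: borel_row_consl mA'.
  by congr Vol; apply/seteqP; split => y /=; rewrite /A'/= !consvD addr0.
rewrite !Vol_cons_swap//; apply: eq_integral => t _ /=.
rewrite -[RHS](lebesgue_measure_translate a); last exact: measurable_consr.
by congr lebesgue_measure; apply/seteqP; split => x /=;
  rewrite /A'/= !consvD addr0.
Qed.

(* Cavalieri's principle along the lines of direction [u]; quantifying over the
   multiples of [u] avoids having to rescale the one-dimensional measure. *)
Lemma Vol_le_sections n (u : 'rV[R]_n) (A B : set 'rV[R]_n) :
    u != 0%R -> borel_row A -> borel_row B ->
    (forall (k : R) (y : 'rV[R]_n), k != 0%R ->
      lebesgue_measure [set t : RR | A (y + t *: (k *: u))%R] <=
      lebesgue_measure [set t : RR | B (y + t *: (k *: u))%R]) ->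
  Vol A <= Vol B.
Proof.
elim: n => [|n IH] in u A B *; first by rewrite thinmx0 eqxx.
rewrite (consv_eta _ u); move: (u 0%R 0%R) (rsubmx _) => a w aw0 mA mB AB.
(* If [a = 0], the lines of direction [u] stay inside the slices of constant first coordinate, and
   the induction hypothesis compares slice with slice. *)
have [a0|a0] := eqVneq a 0%R.
  rewrite !Vol_cons; apply: ge0_le_integral => //.
  - exact: measurable_Vol_consl.
  - exact: measurable_Vol_consl.
  - move=> x _; apply: (IH w); [|exact: borel_row_consl|exact: borel_row_consl|].
    + apply: contra aw0 => /eqP ->; rewrite a0; apply/eqP/rowP => i.
      by case: (unliftP ord0 i) => [j|] ->; rewrite ?consvS ?consv0 !mxE.
    + move=> k y k0; have := AB k (consv x y) k0.
      by congr (lebesgue_measure _ <= lebesgue_measure _); apply/seteqP;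
        split=> t /=; rewrite !consvZ consvD a0 !mulr0 addr0.
(* The shear [x |-> x + x_0 (0, z)] preserves volume and turns the lines of
   direction [u] into lines of direction [e_0]. *)
pose z := (a^-1 *: w)%R.
have za t y : (consv 0 y + t *: (a^-1 *: consv a w) = consv t (y + t *: z))%R.
  by rewrite !consvZ mulVf// consvD mulr1 add0r.
have shear C : borel_row C -> Vol C = \int[@lebesgue_tuple R n]_t
    lebesgue_measure [set x : RR | C (consv x (row_of t + x *: z))%R].
  (* The slices of [C'] at fixed first coordinate are translates of those of [C], hence the equality
     of volumes; swapping the order then integrates along the sheared lines. *)
  move=> mC; pose C' := [set x : 'rV[R]_n.+1 | C (x + x 0%R 0%R *: consv 0 z)%R].
  have C'E x y : C' (consv x y) = C (consv x (y + x *: z))%R.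
    by rewrite /C'/= consv0 consvZ consvD mulr0 addr0.
  transitivity (Vol C').
    rewrite !Vol_cons; apply: eq_integral => x _ /=.
    rewrite -[LHS](Vol_translate _ (x *: z)%R); last exact: borel_row_consl.
    by congr Vol; apply/seteqP; split => y /=; rewrite C'E.
  rewrite Vol_cons_swap; last exact: borel_row_shear.
  apply: eq_integral => t _; congr lebesgue_measure.
  by apply/seteqP; split => y /=; rewrite C'E.
have mshear C : borel_row C -> measurable_fun [set: n.-tuple RR] (fun t =>
    lebesgue_measure [set x : RR | C (consv x (row_of t + x *: z))%R]).
  move=> mC; have := measurable_lebesgue_consr _ _ (borel_row_shear _ (consv 0 z) _ mC).
  apply: eq_measurable_fun => t _; congr lebesgue_measure.
  by apply/seteqP; split => x /=; rewrite consv0 consvZ consvD mulr0 addr0.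
rewrite (shear A)// (shear B)//; apply: ge0_le_integral => //.
- exact: mshear.
- exact: mshear.
(* The multiple [a^-1] of the direction has first coordinate 1, so the parameter on the line is the
   first coordinate itself. *)
- move=> t _; have := AB a^-1%R (consv 0 (row_of t)); rewrite invr_eq0 => /(_ a0).
  by congr (lebesgue_measure _ <= lebesgue_measure _); apply/seteqP;
    split=> x /=; rewrite za.
Qed.

End fubini.

(** An open set is the union of the cubes it contains with rational centre and half-side
    [1 / (m + 1)]; [unpickle] enumerates these countably many cubes. *)
Lemma borel_row_open n (U : set 'rV[R]_n) : open U -> borel_row U.
Proof.
move=> oU.
pose box (p : 'rV[rat]_n * nat) : set 'rV[R]_n :=
  [set x | forall i, `|x 0 i - ratr (p.1 0 i)| < p.2.+1%:R^-1].
pose F (k : nat) : set 'rV[R]_n :=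
  if unpickle k is Some p then [set x | box p `<=` U /\ box p x] else set0.
have mF k : borel_row (F k).
  rewrite /F; case: unpickle => [p|]; last first.
    by rewrite /borel_row preimage_set0.
  have [pU|npU] := pselect (box p `<=` U); last first.
    rewrite (_ : [set x | _] = set0) ?/borel_row ?preimage_set0//.
    by apply/seteqP; split => x // -[].
  pose G i : set RR := `](ratr (p.1 0 i) - p.2.+1%:R^-1),
                         (ratr (p.1 0 i) + p.2.+1%:R^-1)[%classic.
  have := @measurable_box R n G (fun i => measurable_itv _).
  rewrite /borel_row; congr measurable; apply/seteqP; split => t /=.
    move=> tG; split => // i; have := tG i.
    by rewrite /G/= in_itv/= mxE ltr_distl.
  by move=> [_ tG] i; have := tG i; rewrite /G/= in_itv/= mxE ltr_distl.
rewrite (_ : U = \bigcup_k F k); last first.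
  apply/seteqP; split => x; last first.
    by move=> [k _]; rewrite /F; case: unpickle => // p [pU]; exact: pU.
  move=> Ux; have /nbhs_ballP[e /= e0 eU] := open_nbhs_nbhs (conj oU Ux).
  (* A cube of half-side below [e / 2] that contains [x] lies in the sup-norm ball of radius [e]
     around [x]. *)
  have [m me] : exists m : nat, m.+1%:R^-1 < e / 2.
    have e20 : 0 < e / 2 by lra.
    have [m _ /(_ m (leqnn m))] := near_infty_natSinv_lt (PosNum e20).
    by exists m.
  have mi : 0 < m.+1%:R^-1 :> R by [].
  have /choice[q qP] i : exists q : rat, `|x 0 i - ratr q| < m.+1%:R^-1.
    move: (m.+1%:R^-1 : R) mi => e' e'0.
    have [|q] := @rat_in_itvoo R (x 0 i - e') (x 0 i + e'); first by lra.
    by rewrite in_itv/= => ?; exists q; rewrite ltr_norml; lra.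
  pose p := (\row_i q i, m) : 'rV[rat]_n * nat.
  exists (pickle p) => //; rewrite /F pickleK; split => [y yp|i]; last first.
    by rewrite mxE; exact: qP.
  apply: eU; split => // i j; rewrite (ord1 i).
  move: (yp j) (qP j) me; rewrite mxE /ball/= !ltr_norml.
  by move: (m.+1%:R^-1) => e'; lra.
rewrite /borel_row preimage_bigcup; apply: bigcup_measurable => k _; exact: mF.
Qed.

End row_vectors.

(** * Factorization of linear contractions *)

Definition dot {R : realType} {d} (x y : 'rV[R]_d) : R :=
  \sum_(i < d) x 0 i * y 0 i.

Definition contracts {R : realType} {d} (M : 'M[R]_d) :=
  forall x : 'rV[R]_d, dot (x *m M) (x *m M) <= dot x x.

(* Multiplies the component along [u] by [1 - c * dot u u]; for
   [c * dot u u = 2] it is the orthogonal reflection in the hyperplane [u^perp]. *)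
Definition squeeze {R : realType} {d} (u : 'rV[R]_d) (c : R) : 'M[R]_d :=
  1%:M - c *: (u^T *m u).

Section euclidean_algebra.
Context {R : realType} {d : nat}.
Implicit Types (x y u v w f : 'rV[R]_d) (M : 'M[R]_d).

Lemma dotE x y : dot x y = (x *m y^T) 0 0.
Proof. by rewrite mxE; apply: eq_bigr => i _; rewrite mxE. Qed.

Lemma dotC x y : dot x y = dot y x.
Proof. by apply: eq_bigr => i _; rewrite mulrC. Qed.

Lemma dotDl x y z : dot (x + y) z = dot x z + dot y z.
Proof. by rewrite !dotE mulmxDl mxE. Qed.

Lemma dotDr x y z : dot z (x + y) = dot z x + dot z y.
Proof. by rewrite !(dotC z) dotDl. Qed.

Lemma dotZl a x y : dot (a *: x) y = a * dot x y.
Proof. by rewrite !dotE -scalemxAl mxE. Qed.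

Lemma dotZr a x y : dot x (a *: y) = a * dot x y.
Proof. by rewrite !(dotC x) dotZl. Qed.

Lemma dotNl x y : dot (- x) y = - dot x y.
Proof. by rewrite -scaleN1r dotZl mulN1r. Qed.

Lemma dotNr x y : dot x (- y) = - dot x y.
Proof. by rewrite !(dotC x) dotNl. Qed.

Lemma dot0l y : dot 0 y = 0.
Proof. by rewrite !dotE mul0mx mxE. Qed.

Lemma dot_mulmxl x y M : dot (x *m M) y = dot x (y *m M^T).
Proof. by rewrite !dotE trmx_mul trmxK mulmxA. Qed.

Lemma dot_ge0 x : 0 <= dot x x.
Proof. by apply: sumr_ge0 => i _; rewrite -expr2 sqr_ge0. Qed.

Lemma dot_eq0 x : dot x x = 0 -> x = 0.
Proof.
move=> /eqP; rewrite psumr_eq0; last by move=> i _; rewrite -expr2 sqr_ge0.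
move=> /allP x0; apply/rowP => i; rewrite mxE; apply/eqP.
by have := x0 i (mem_index_enum i); rewrite /= mulf_eq0 orbb.
Qed.

Lemma dot_gt0 x : x != 0 -> 0 < dot x x.
Proof.
move=> x0; rewrite lt_neqAle dot_ge0 andbT eq_sym; apply: contra x0 => /eqP.
by move/dot_eq0 => ->.
Qed.

Definition dotlin := (dotDl, dotDr, dotZl, dotZr, dotNl, dotNr).

Lemma enorm_dot x : enorm x = Num.sqrt (dot x x).
Proof. by congr Num.sqrt; apply: eq_bigr => i _; rewrite expr2. Qed.

Lemma mulmx_squeeze u c x : x *m squeeze u c = x - (c * dot x u) *: u.
Proof.
rewrite /squeeze mulmxBr mulmx1 -scalemxAr mulmxA; congr (_ - _).
by rewrite [x *m u^T]mx11_scalar -dotE mul_scalar_mx scalerA.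
Qed.

(** The squared norm of [x] drops by exactly [c * dot x u ^+ 2 * (2 - c * dot u u)]. *)
Lemma contracts_squeeze u c :
  0 <= c -> c * dot u u <= 2 -> contracts (squeeze u c).
Proof.
move=> c0 cu x; rewrite mulmx_squeeze !dotlin (dotC u x).
have : 0 <= c * (dot x u ^+ 2) * (2 - c * dot u u).
  by rewrite mulr_ge0 ?subr_ge0// mulr_ge0 ?sqr_ge0.
by move: (dot x x) (dot x u) (dot u u) => a b e; nra.
Qed.

Lemma contractsM M N : contracts M -> contracts N -> contracts (M *m N).
Proof. by move=> cM cN x; rewrite mulmxA (le_trans (cN _)). Qed.

Lemma eq0_linear_bounded (p b : R) : (forall t, t * p <= b) -> p = 0.
Proof.
move=> pb; apply/eqP; apply/negP => /negP p0.
by have := pb ((b + 1) / p); rewrite divfK//; lra.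
Qed.

Lemma eq0_linear_quadratic (p q : R) : (forall t, t * p <= t ^+ 2 * q) -> p = 0.
Proof.
move=> pq; apply/eqP; apply/negP => /negP p0.
(* As [q'] is positive and exceeds [q], at [t = p / q'] the linear term beats the quadratic one. *)
pose q' := `|q| + 1; have q'0 : 0 < q' by rewrite ltr_wpDl.
have qq' : q < q' by rewrite /q' (le_lt_trans (ler_norm q))// ltrDl.
have := pq (p / q'); rewrite leNgt => /negP; apply.
rewrite (_ : (p / q') ^+ 2 * q = (p / q') * p * (q / q')); last by field; rewrite gt_eqF.
have pp : 0 < p / q' * p.
  by rewrite mulrAC mulr_gt0 ?invr_gt0// -expr2 exprn_even_gt0.
rewrite -subr_gt0 -[X in 0 < X - _]mulr1 -mulrBr mulr_gt0// subr_gt0.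
by rewrite ltr_pdivrMr// mul1r.
Qed.

(** The loss of squared norm at [t *: f + x] is affine in [t] and nonnegative for all [t], so its
    slope vanishes. In effect [M^T] fixes [f] too, and [M] preserves the orthogonal complement of
    its fixed space. *)
Lemma dot_fixed M f x : contracts M -> f *m M = f -> dot f (x *m M) = dot f x.
Proof.
move=> cM fM; apply/eqP; rewrite -subr_eq0; apply/eqP.
apply: (@eq0_linear_bounded _ ((dot x x - dot (x *m M) (x *m M)) / 2)) => t.
have := cM (t *: f + x); rewrite mulmxDl -scalemxAl fM !dotlin.
rewrite (dotC x f) (dotC (x *m M) f); lra.
Qed.

(** * Continuity, and compactness of the unit sphere orthogonal to the fixed space *)

Lemma continuous_sum (T : topologicalType) (F : 'I_d -> T -> R) :
  (forall i, continuous (F i)) -> continuous (fun t => \sum_(i < d) F i t).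
Proof. by move=> cF; apply: continuous_big => //; exact: add_continuous. Qed.

Lemma continuous_dot (T : topologicalType) (g h : T -> 'rV[R]_d) :
    (forall i, continuous (fun t => g t 0 i)) ->
    (forall i, continuous (fun t => h t 0 i)) ->
  continuous (fun t => dot (g t) (h t)).
Proof.
move=> cg ch; apply: continuous_sum => i x.
by apply: cvgM; [exact: cg|exact: ch].
Qed.

Lemma continuous_mulmx_coord M i : continuous (fun x : 'rV[R]_d => (x *m M) 0 i).
Proof.
rewrite (_ : (fun _ => _) = (fun x : 'rV[R]_d => \sum_(j < d) x 0 j * M j i)).
  apply: continuous_sum => j x.
  by apply: continuousM; [exact: coord_continuous|exact: cst_continuous].
by apply/funext => x; rewrite mxE.
Qed.

Lemma closed_eq (T : topologicalType) (g : T -> R) (a : R) :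
  continuous g -> closed [set x | g x = a].
Proof.
by move=> cg; apply: (@preimage_closed _ _ g [set a]) => // x _; exact: cg.
Qed.

Lemma fixed_perp_nontrivial M : M != 1%:M ->
  exists2 z : 'rV[R]_d, z != 0 & forall f, f *m M = f -> dot f z = 0.
Proof.
(* The rows of [N] span the fixed space and those of [K] its orthogonal complement, whose dimension
   is the rank of [M - 1%:M]. *)
move=> M1; pose N := kermx (M - 1%:M); pose K := kermx N^T.
have rM : (0 < \rank (M - 1%:M)%R)%N by rewrite lt0n mxrank_eq0 subr_eq0.
have Mn := rank_leq_row (M - 1%:M).
exists (nz_row K).
  rewrite nz_row_eq0 -mxrank_eq0 /K mxrank_ker mxrank_tr /N mxrank_ker.
  by rewrite subKn// -lt0n.
move=> f fM; have /sub_kermxP Kz := nz_row_sub K.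
have /submxP[D ->] : (f <= N)%MS.
  by apply/sub_kermxP; rewrite mulmxBr mulmx1 fM subrr.
by rewrite dotE -mulmxA -[N]trmxK -trmx_mul Kz trmx0 mulmx0 mxE.
Qed.

Lemma compact_fixed_perp_sphere M :
  compact [set x : 'rV[R]_d | dot x x = 1 /\ forall f, f *m M = f -> dot f x = 0].
Proof.
apply: bounded_closed_compact.
  exists 1; split; first exact: num_real.
  move=> b b1 x [xx _] /=; rewrite (le_trans _ (ltW b1))//.
  have [->|x0] := eqVneq x 0; first by rewrite normr0.
  have /mx_norm_neq0[[i j] xE] : mx_norm x != 0 by rewrite (normr_eq0 x).
  rewrite [leLHS]xE /= (ord1 i) -(@expr_le1 _ 2)// real_normK ?num_real// -xx.
  rewrite /dot (bigD1 j)//= -expr2 lerDl.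
  by apply: sumr_ge0 => k _; rewrite -expr2 sqr_ge0.
have c i : continuous (fun x : 'rV[R]_d => x 0 i) by exact: coord_continuous.
rewrite (_ : [set x | _] = [set x | dot x x = 1] `&`
    \bigcap_(f in [set f | f *m M = f]) [set x | dot f x = 0]).
  apply: closedI; first by apply: closed_eq; exact: continuous_dot.
  apply: closed_bigI => f _; apply: closed_eq; apply: continuous_dot => //.
  by move=> i; exact: cst_continuous.
by [].
Qed.

(** A singular pair orthogonal to the fixed space: a maximiser [v] of [g] on the sphere [S] is an
    eigenvector of [M *m M^T] for the eigenvalue [g v], and [s] is the square root of [g v]. *)
Lemma singular_pair M : contracts M -> M != 1%:M ->
  exists v w s, [/\ dot v v = 1, dot w w = 1 & 0 <= s <= 1] /\
    [/\ v *m M = s *: w, w *m M^T = s *: v &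
      forall f, f *m M = f -> dot f v = 0 /\ dot f w = 0].
Proof.
move=> cM M1; pose g x := dot (x *m M) (x *m M).
pose S := [set x | dot x x = 1 /\ forall f, f *m M = f -> dot f x = 0].
have S_unit x : x != 0 -> (forall f, f *m M = f -> dot f x = 0) ->
    S ((Num.sqrt (dot x x))^-1 *: x).
  move=> x0 xF; split => [|f /xF fx]; last by rewrite dotZr fx mulr0.
  rewrite dotZl dotZr mulrA -expr2 exprVn sqr_sqrtr ?dot_ge0// mulVf//.
  by rewrite gt_eqF// dot_gt0.
have [v vS gv] : exists2 v, v \in S & forall x, x \in S -> g x <= g v.
  apply: EVT_max_rV; last 2 first.
  - exact: compact_fixed_perp_sphere.
  - apply: continuous_subspaceT; apply: continuous_dot => i;
      exact: continuous_mulmx_coord.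
  by have [z z0 zF] := fixed_perp_nontrivial _ M1; eexists; exact: S_unit zF.
have [vv vF] := set_mem vS.
have gmax x : (forall f, f *m M = f -> dot f x = 0) -> g x <= g v * dot x x.
  move=> xF; have [->|x0] := eqVneq x 0.
    by rewrite /g mul0mx !dot0l mulr0.
  have := gv _ (mem_set (S_unit _ x0 xF)).
  rewrite /g -scalemxAl dotZl dotZr mulrA -expr2 exprVn sqr_sqrtr ?dot_ge0//.
  by rewrite mulrC ler_pdivrMr// dot_gt0.
(* The defect [z] is orthogonal to [v] and to the fixed space, so [v + t *: z] is an admissible
   perturbation. Maximality kills the first-order term, which is twice [dot z z]. *)
have vvM : v *m M *m M^T = g v *: v.
  apply/eqP; rewrite -subr_eq0; apply/eqP/dot_eq0; move zE : (_ - _) => z.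
  have zF f : f *m M = f -> dot f z = 0.
    move=> fM; rewrite -zE dotDr dotNr dotZr (vF _ fM) -dot_mulmxl fM.
    by rewrite (dot_fixed _ _ _ cM fM) (vF _ fM) mulr0 subr0.
  have vz : dot v z = 0.
    by rewrite -zE dotDr dotNr dotZr vv -dot_mulmxl -/(g v) mulr1 subrr.
  have vzM : dot (v *m M) (z *m M) = 0.
    apply/eqP; rewrite -(mulrI_eq0 _ (@mulfI _ 2 _))//; apply/eqP.
    apply: (@eq0_linear_quadratic _ (g v * dot z z - g z)) => t.
    have := gmax (v + t *: z); rewrite /g mulmxDl -scalemxAl !dotlin.
    rewrite (dotC z v) vz vv (dotC (z *m M) (v *m M)) => gt.
    have /gt : forall f, f *m M = f -> dot f (v + t *: z) = 0.
      by move=> f fM; rewrite dotDr dotZr vF// zF// mulr0 addr0.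
    by rewrite -/(g v) -/(g z); lra.
  rewrite -{1}zE dotDl dotNl dotZl vz mulr0 subr0.
  by rewrite dotC -dot_mulmxl dotC.
have gv0 : 0 <= g v by exact: dot_ge0.
have gv1 : g v <= 1 by rewrite -vv; exact: cM.
(* When the maximum is 0, [M] kills the whole complement of the fixed space, which contains both [v]
   and [v *m M^T]; then [w = v] serves. *)
have [s0|s0] := eqVneq (g v) 0.
  exists v, v, 0; rewrite lexx ler01 !scale0r; split=> //; split.
  - exact: dot_eq0.
  - apply: dot_eq0; move zE : (v *m _) => z.
    have zF f : f *m M = f -> dot f z = 0.
      by move=> fM; rewrite -zE -dot_mulmxl fM vF.
    have := gmax _ zF; rewrite s0 mul0r => gz.
    have /dot_eq0 zM : g z = 0 by apply/eqP; rewrite eq_le gz dot_ge0.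
    by rewrite -{2}zE -dot_mulmxl zM dot0l.
  - by move=> f /vF.
pose s := Num.sqrt (g v).
have ss : s * s = g v by rewrite -expr2 sqr_sqrtr.
have sn0 : s != 0 by rewrite sqrtr_eq0 -ltNge lt_neqAle eq_sym s0.
exists v, (s^-1 *: (v *m M)), s; split; split => //.
- by rewrite !dotlin -/(g v) -ss mulKf// mulVf.
- by rewrite sqrtr_ge0/= -sqrtr1 ler_sqrt.
- by rewrite scalerA divff// scale1r.
- by rewrite -scalemxAl vvM scalerA -ss mulKf.
- move=> f fM; rewrite dotZr (dot_fixed _ _ _ cM fM) vF//.
  by rewrite mulr0.
Qed.

Lemma squeeze0 : squeeze (0 : 'rV[R]_d) 0 = 1%:M.
Proof. by rewrite /squeeze scale0r subr0. Qed.

Lemma eq_mulmx_row M N : (forall x, x *m M = x *m N) -> M = N.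
Proof. by move=> MN; apply/row_matrixP => i; rewrite !rowE. Qed.

Lemma squeeze_involutive u c : c * dot u u = 2 ->
  squeeze u c *m squeeze u c = 1%:M.
Proof.
move=> cu; apply: eq_mulmx_row => x; rewrite mulmxA !mulmx_squeeze mulmx1.
rewrite dotDl dotNl dotZl -addrA -opprD -scalerDl.
rewrite (_ : _ + _ = c * dot x u * (2 - c * dot u u)); last by ring.
by rewrite cu subrr mulr0 scale0r subr0.
Qed.

(** The reflection in the hyperplane orthogonal to [v - w] exchanges the two unit vectors; when they
    coincide, the identity [squeeze 0 0] is taken instead. *)
Lemma reflection_swap v w : dot v v = 1 -> dot w w = 1 ->
  exists u c, [/\ 0 <= c, c * dot u u <= 2, w *m squeeze u c = v,
    squeeze u c *m squeeze u c = 1%:M &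
    forall f, dot f v = 0 -> dot f w = 0 -> f *m squeeze u c = f].
Proof.
move=> vv ww; have [<-|vw] := eqVneq v w.
  exists 0, 0; rewrite squeeze0 !mulmx1 mul0r lexx ler0n; split=> // f _ _.
  by rewrite mulmx1.
have u0 : 0 < dot (v - w) (v - w) by rewrite dot_gt0// subr_eq0.
exists (v - w), (2 / dot (v - w) (v - w)).
have cu : 2 / dot (v - w) (v - w) * dot (v - w) (v - w) = 2.
  by rewrite divfK// gt_eqF.
split; rewrite ?cu//.
- by rewrite divr_ge0 ?ler0n// ltW.
(* For unit vectors, [dot w (v - w)] is minus half of [dot (v - w) (v - w)]. *)
- rewrite mulmx_squeeze (_ : _ * _ = -1); last first.
    move: cu u0; rewrite !dotlin vv ww (dotC w v) => cu u0.
    by apply: (mulIf (lt0r_neq0 u0)); rewrite mulrAC cu; ring.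
  by rewrite scaleN1r opprK addrC subrK.
- exact: squeeze_involutive.
- move=> f fv fw; have fvw : dot f (v - w) = 0 by rewrite dotDr dotNr fv fw subrr.
  by rewrite mulmx_squeeze fvw mulr0 scale0r subr0.
Qed.

Lemma contraction_factor M : contracts M -> M != 1%:M ->
  exists v c u k (M' : 'M[R]_d),
  [/\ M = squeeze v c *m M' *m squeeze u k, 0 <= c /\ c * dot v v <= 2,
      0 <= k /\ k * dot u u <= 2, contracts M' &
      (\rank (M' - 1%:M)%R < \rank (M - 1%:M)%R)%N].
Proof.
move=> cM M1.
have [v [w [s [[vv ww /andP[s0 s1]] [vM wM vwF]]]]] := singular_pair _ cM M1.
have [u [k [k0 ku wH HH fH]]] := reflection_swap _ _ vv ww.
(* This matrix sends [v] to [w] and agrees with [M] on the complement of [v], whence [M] is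
   [squeeze v (1 - s) *m M']. The factor supplied in the end is [M' *m squeeze u k], which fixes
   [v]. *)
pose M' := M + (1 - s) *: (v^T *m w).
have xM' x : x *m M' = x *m M + ((1 - s) * dot x v) *: w.
  rewrite mulmxDr -scalemxAr mulmxA [x *m v^T]mx11_scalar -dotE.
  by rewrite mul_scalar_mx scalerA.
have vM' : v *m M' = w.
  by rewrite xM' vv vM mulr1 -scalerDl addrC subrK scale1r.
have cM' : contracts M'.
  move=> x; have [y xE] : exists y, x = y + dot x v *: v.
    by exists (x - dot x v *: v); rewrite subrK.
  have yv : dot y v = 0.
    by have := congr1 (dot^~ v) xE; rewrite dotDl dotZl vv; lra.
  have yM' : y *m M' = y *m M by rewrite xM' yv mulr0 scale0r addr0.
  (* So the images of [y] and [v] stay orthogonal, and Pythagoras reduces the bound to that of [M]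
     at [y]. *)
  have yMw : dot (y *m M) w = 0 by rewrite dot_mulmxl wM dotZr yv mulr0.
  rewrite xE; move: (dot x v) => a; rewrite mulmxDl -scalemxAl vM' yM' !dotlin vv ww.
  rewrite (dotC w) (dotC v y) yMw yv.
  by have := cM y; lra.
have cH : contracts (squeeze u k) by exact: contracts_squeeze.
exists v, (1 - s), u, k, (M' *m squeeze u k); split.
- rewrite mulmxA -(mulmxA _ _ (squeeze u k)) HH mulmx1; apply: eq_mulmx_row => x.
  by rewrite mulmxA mulmx_squeeze mulmxBl -scalemxAl vM' xM' addrK.
- by rewrite subr_ge0 s1 vv mulr1; lra.
- by [].
- exact: contractsM.
(* The old fixed vectors remain fixed and [v] is a new one: it was orthogonal to all the old ones,
   hence not among them. *)
have : (kermx (M - 1%:M) < kermx (M' *m squeeze u k - 1%:M))%MS.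
  apply/andP; split.
    apply/row_subP => i; apply/sub_kermxP; set f := row i _.
    have fM : f *m M = f.
      have /sub_kermxP : (f <= kermx (M - 1%:M))%MS by exact: row_sub.
      by rewrite mulmxBr mulmx1 => /subr0_eq.
    have [fv fw] := vwF _ fM.
    by rewrite mulmxBr mulmx1 mulmxA xM' fv mulr0 scale0r addr0 fM fH// subrr.
  apply/negP => kk; have : (v <= kermx (M - 1%:M))%MS.
    apply: submx_trans kk; apply/sub_kermxP.
    by rewrite mulmxBr mulmx1 mulmxA vM' wH subrr.
  move/sub_kermxP; rewrite mulmxBr mulmx1 => /subr0_eq /vwF[+ _].
  by rewrite vv => /eqP; rewrite oner_eq0.
move/rank_ltmx; rewrite !mxrank_ker.
have := rank_leq_row (M - 1%:M); have := rank_leq_row (M' *m squeeze u k - 1%:M).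
move: (\rank _) (\rank _) => a b; lia.
Qed.

(** Induction on the rank of [M - 1%:M], the codimension of the fixed space; the base case is the
    identity as [squeeze 0 0]. *)
Lemma contraction_ind (P : 'M[R]_d -> Prop) :
    (forall u c, 0 <= c -> c * dot u u <= 2 -> P (squeeze u c)) ->
    (forall M N, P M -> P N -> P (M *m N)) ->
  forall M, contracts M -> P M.
Proof.
move=> Psq PM M; have [n] := ubnP (\rank (M - 1%:M)%R).
elim: n => // n IH in M * => rM cM.
have [->|M1] := eqVneq M 1%:M.
  by rewrite -squeeze0; apply: Psq; rewrite ?mul0r ?ler0n.
have [v [c [u [k [M' [ME [c0 cv] [k0 ku] cM' rM']]]]]] := contraction_factor _ cM M1.
have PM' : P M' by apply: IH => //; rewrite (leq_trans rM').
rewrite ME; exact: (PM _ _ (PM _ _ (Psq _ _ c0 cv) PM') (Psq _ _ k0 ku)).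
Qed.

End euclidean_algebra.

(** * Volume of parallel bodies of convex sets *)

Definition convex_in {R : realType} {d} (K : set 'rV[R]_d) :=
  forall x y (t : R), 0 <= t <= 1 -> K x -> K y -> K (t *: x + (1 - t) *: y).

Section convex_sets.
Context {R : realType} {d : nat}.
Local Notation RR := (measurableTypeR R).
Implicit Types (K : set 'rV[R]_d) (x y u v b : 'rV[R]_d) (M : 'M[R]_d) (r : R).

Lemma dilate_unit_ballE r : 0 < r ->
  dilate r unit_ball = [set b : 'rV[R]_d | dot b b < r ^+ 2].
Proof.
move=> r0; have enorm1 x : (enorm x < 1) = (dot x x < 1).
  by rewrite enorm_dot -{1}sqrtr1 ltr_sqrt.
apply/seteqP; split => [_ [x + <-]|b /= br].
  rewrite /unit_ball/= enorm1 dotZl dotZr mulrA -expr2 => x1.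
  by rewrite gtr_pMr// exprn_gt0.
exists (r^-1 *: b); last by rewrite scalerA divff ?scale1r// gt_eqF.
rewrite /unit_ball/= enorm1 dotZl dotZr mulrA -expr2 exprVn mulrC.
by rewrite ltr_pdivrMr ?mul1r// exprn_gt0.
Qed.

Lemma minkowski_ballP K r x : 0 < r ->
  minkowski_sum K (dilate r unit_ball) x <->
  exists y b, [/\ K y, dot b b < r ^+ 2 & x = y + b].
Proof.
move=> r0; rewrite dilate_unit_ballE//; split.
  by move=> [y Ky [b bb <-]]; exists y, b.
by move=> [y [b [Ky bb ->]]]; exists y => //; exists b.
Qed.

Lemma open_minkowski_ball K r : 0 < r ->
  open (minkowski_sum K (dilate r unit_ball)).
Proof.
move=> r0; rewrite (_ : minkowski_sum _ _ =
    \bigcup_(y in K) [set x | dot (x - y) (x - y) < r ^+ 2]).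
  apply: bigcup_open => y _.
  apply: (@open_comp _ _ (fun x => dot (x - y) (x - y)) [set s | s < r ^+ 2]).
    move=> x _; apply: continuous_dot => i;
    rewrite (_ : (fun t : 'rV[R]_d => _) = (fun t : 'rV[R]_d => t 0 i - y 0 i));
      try (by apply/funext => t; rewrite !mxE);
      by move=> t; apply: continuousB;
        [exact: coord_continuous|exact: cst_continuous].
  exact: open_lt.
apply/seteqP; split => [x /(minkowski_ballP _ _ _ r0)[y [b [Ky bb ->]]]|x [y Ky]/= xy].
  by exists y => //=; rewrite addrAC subrr add0r.
by apply/minkowski_ballP => //; exists y, (x - y); split=> //; rewrite addrC subrK.
Qed.

Lemma borel_row_minkowski_ball K r : 0 < r ->
  borel_row (minkowski_sum K (dilate r unit_ball)).
Proof. by move=> r0; apply: borel_row_open; exact: open_minkowski_ball. Qed.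

Lemma convex_in_image K M : convex_in K -> convex_in ((fun x => x *m M) @` K).
Proof.
move=> cK _ _ t t01 [x Kx <-] [y Ky <-]; exists (t *: x + (1 - t) *: y).
  exact: cK.
by rewrite mulmxDl -!scalemxAl.
Qed.

Lemma convex_in_minkowski_ball K r : 0 < r -> convex_in K ->
  convex_in (minkowski_sum K (dilate r unit_ball)).
Proof.
move=> r0 cK x y t t01 /(minkowski_ballP _ _ _ r0)[x' [b [Kx' bb ->]]].
move=> /(minkowski_ballP _ _ _ r0)[y' [b' [Ky' bb' ->]]].
apply/minkowski_ballP => //.
exists (t *: x' + (1 - t) *: y'), (t *: b + (1 - t) *: b'); split.
- exact: cK.
- have /andP[t0 t1] := t01.
  (* This is the amount by which the convex combination of the squared norms exceeds the squared
     norm of the combination. *)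
  have : 0 <= t * (1 - t) * dot (b - b') (b - b').
    by rewrite !mulr_ge0 ?dot_ge0// subr_ge0.
  rewrite !dotlin (dotC b' b).
  have : t * dot b b + (1 - t) * dot b' b' < r ^+ 2.
    have [->|tn0] := eqVneq t 0; first by rewrite mul0r add0r subr0 mul1r.
    have : 0 < t * (r ^+ 2 - dot b b).
      by rewrite mulr_gt0 ?subr_gt0// lt_neqAle eq_sym tn0.
    have : 0 <= (1 - t) * (r ^+ 2 - dot b' b').
      by rewrite mulr_ge0 ?subr_ge0// ltW.
    by move: (r ^+ 2) => r2; lra.
  by move: (r ^+ 2) => r2; lra.
- by rewrite !scalerDr addrACA.
Qed.

Lemma is_interval_section K u y : convex_in K ->
  is_interval [set t : R | K (y + t *: u)].
Proof.
move=> cK s t /= Ks Kt z /andP[sz zt].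
have [st|ts] := ltP s t; last first.
  by have -> : z = s by apply/eqP; rewrite eq_le sz (le_trans zt ts).
pose l := (t - z) / (t - s).
have l01 : 0 <= l <= 1.
  rewrite /l ler_pdivrMr ?subr_gt0// mul1r lerD2l lerN2 sz andbT.
  by rewrite divr_ge0 ?subr_ge0// ltW.
have := cK _ _ _ l01 Ks Kt; congr K.
rewrite !scalerDr !scalerA addrACA -!scalerDl.
rewrite [l + _]addrC subrK scale1r; congr (_ + _ *: _).
by rewrite /l; field; rewrite subr_eq0 gt_eqF.
Qed.

(** Any segment with endpoints in [I] lies in [I], so distances in [J] are bounded by the measure
    [L] of [I], and [J] fits into the segment of length [L] starting at its infimum. *)
Lemma lebesgue_measure_le_diam (I J : set RR) : is_interval (I : set R) ->
    measurable J ->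
    (forall s t : R, J s -> J t -> exists a b : R, [/\ I a, I b & t - s <= b - a]) ->
  (lebesgue_measure J <= lebesgue_measure I)%E.
Proof.
move=> itvI mJ JI; have [->|/set0P[j0 Jj0]] := eqVneq J set0.
  by rewrite measure0 measure_ge0.
have mI : measurable I by exact: is_interval_measurable.
have [->|Ifin] := eqVneq (lebesgue_measure I) +oo%E; first exact: leey.
have [L LE] : exists L : R, lebesgue_measure I = L%:E.
  exists (fine (lebesgue_measure I)); rewrite fineK// ge0_fin_numE ?measure_ge0//.
  by rewrite ltey.
have L0 : 0 <= L by rewrite -lee_fin -LE measure_ge0.
have JL (s t : R) : J s -> J t -> t - s <= L.
  move=> Js Jt; have [a [b [Ia Ib /le_trans]]] := JI _ _ Js Jt; apply.
  have [ab|ba] := leP a b; last by rewrite (le_trans _ L0)// subr_le0 ltW.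
  rewrite -lee_fin -LE.
  have <- : lebesgue_measure (`[a, b]%classic : set RR) = (b - a)%:E.
    rewrite lebesgue_measure_itv/= lte_fin; case: ifPn => // /negbTE ba.
    by move: ab; rewrite le_eqVlt ba orbF => /eqP ->; rewrite subrr.
  apply: le_measure; rewrite ?inE// => z /=; rewrite in_itv/= => abz.
  exact: itvI Ia Ib _ abz.
pose m := inf (J : set R).
have hJ : has_inf (J : set R).
  split; first by exists j0.
  by exists (j0 - L) => t Jt; have := JL _ _ Jt Jj0; lra.
have mt (t : R) : J t -> m <= t by move=> Jt; apply: ge_inf => //; case: hJ.
have tm (t : R) : J t -> t <= m + L.
  move=> Jt; rewrite -lerBlDr; apply: lb_le_inf; first by case: hJ.
  by move=> s Js; have := JL _ _ Js Jt; lra.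
rewrite LE; apply: (@le_trans _ _ (lebesgue_measure (`[m, m + L]%classic : set RR))).
  apply: le_measure; rewrite ?inE//.
  by move=> t Jt /=; rewrite in_itv/= mt// tm.
rewrite lebesgue_measure_itv/= lte_fin; case: ifPn => _; last by rewrite lee_fin.
by rewrite lee_fin; lra.
Qed.

(* Write [a], [b] for the components along [u] of the points of [K] and of the
   ball.  A point [t] of the section of [K *m squeeze u c + rB] has the form
   [(1 - c |u|^2) a + b - h].  The section of [K + rB] contains [a + b - h] and,
   the ball being symmetric, [a - b - h]; as [|1 - c |u|^2| <= 1], one of the two
   choices of sign gives endpoints that are at least as far apart. *)
Lemma section_squeeze_le K r u c y : 0 < r -> convex_in K -> u != 0 ->
    0 <= c -> c * dot u u <= 2 ->
  (lebesgue_measure [set t : RR |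
     minkowski_sum ((fun x => x *m squeeze u c) @` K) (dilate r unit_ball)
       (y + (t : R) *: u)%R] <=
   lebesgue_measure [set t : RR |
     minkowski_sum K (dilate r unit_ball) (y + (t : R) *: u)%R])%E.
Proof.
move=> r0 cK u0 c0 cu; have D0 := dot_gt0 _ u0.
apply: lebesgue_measure_le_diam.
- by apply: is_interval_section; exact: convex_in_minkowski_ball.
- apply: open_measurable; apply: (@open_comp R 'rV[R]_d (fun t => y + t *: u)).
    by move=> t _; apply: cvgD; [exact: cvg_cst|apply: cvgZr_tmp; exact: cvg_id].
  exact: open_minkowski_ball.
pose B t := minkowski_sum K (dilate r unit_ball) (y + t *: u).
have points (t : R) :
    minkowski_sum ((fun x => x *m squeeze u c) @` K) (dilate r unit_ball)
      (y + t *: u) ->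
    exists a b : R, [/\ t = (1 - c * dot u u) * a + b - dot y u / dot u u,
      B (a + b - dot y u / dot u u) & B (a - b - dot y u / dot u u)].
  move=> /(minkowski_ballP _ _ _ r0)[_ [b [[x Kx <-] bb yE]]].
  rewrite mulmx_squeeze in yE.
  have tE : t = (1 - c * dot u u) * (dot x u / dot u u) + dot b u / dot u u
      - dot y u / dot u u.
    have := congr1 (dot^~ u) yE; rewrite !dotlin => tE.
    apply: (mulIf (lt0r_neq0 D0)); apply: (addrI (dot y u)); rewrite tE.
    by field; rewrite gt_eqF.
  exists (dot x u / dot u u), (dot b u / dot u u); split=> //.
  - apply/minkowski_ballP => //; exists x, b; split=> //.
    have -> : dot x u / dot u u + dot b u / dot u u - dot y u / dot u u =
        t + c * dot x u by rewrite tE; field; rewrite gt_eqF.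
    by rewrite scalerDl addrA yE addrAC subrK.
  - apply/minkowski_ballP => //.
    (* The mirror image of [b] in the hyperplane orthogonal to [u]: same norm, opposite component
       along [u]. *)
    exists x, (b - (2 * (dot b u / dot u u)) *: u); split=> //.
      rewrite !dotlin (dotC u b) [X in X < _](_ : _ = dot b b)//.
      by field; rewrite gt_eqF.
    have -> : dot x u / dot u u - dot b u / dot u u - dot y u / dot u u =
        t + c * dot x u - 2 * (dot b u / dot u u) by rewrite tE; field; rewrite gt_eqF.
    by rewrite scalerBl scalerDl !addrA yE [X in X - _]addrAC subrK.
move=> s t /points[a1 [b1 [sE P1 Q1]]] /points[a2 [b2 [tE P2 Q2]]].
have cu0 : 0 <= c * dot u u by rewrite mulr_ge0// ltW.
(* Up to the factor [1 - c * dot u u] on [a2 - a1], [t - s] is [(a2 - a1) + (b2 - b1)]; the sign of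
   [a2 - a1] decides whether the mirrored points are used. *)
have [aa|aa] := leP a1 a2.
  exists (a1 + b1 - dot y u / dot u u), (a2 + b2 - dot y u / dot u u); split => //.
  by rewrite sE tE; move: (c * dot u u) (_ / _) cu0 cu => e h; nra.
exists (a2 - b2 - dot y u / dot u u), (a1 - b1 - dot y u / dot u u); split => //.
by rewrite sE tE; move: (c * dot u u) (_ / _) cu0 cu => e h; nra.
Qed.

Lemma Vol_squeeze_le K r u c : 0 < r -> convex_in K ->
    0 <= c -> c * dot u u <= 2 ->
  (Vol (minkowski_sum ((fun x => x *m squeeze u c) @` K) (dilate r unit_ball)) <=
   Vol (minkowski_sum K (dilate r unit_ball)))%E.
Proof.
move=> r0 cK c0 cu; have [u0|u0] := eqVneq u 0.
  rewrite (_ : _ @` K = K)//; apply/seteqP; split => [_ [x Kx <-]|x Kx].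
    by rewrite mulmx_squeeze u0 scaler0 subr0.
  by exists x => //; rewrite mulmx_squeeze u0 scaler0 subr0.
apply: (@Vol_le_sections _ _ u) => //; try exact: borel_row_minkowski_ball.
move=> k y k0.
(* The squeeze depends only on the line of [u] and on [c * dot u u], so the section bound holds for
   every multiple of [u]. *)
have -> : squeeze u c = squeeze (k *: u) (c / k ^+ 2).
  apply: eq_mulmx_row => x; rewrite !mulmx_squeeze dotZr scalerA.
  by congr (_ - _ *: _); field.
apply: section_squeeze_le => //.
- by rewrite scaler_eq0 negb_or k0.
- by rewrite divr_ge0// sqr_ge0.
- by rewrite dotZl dotZr (_ : _ * _ = c * dot u u)//; field.
Qed.

Lemma Vol_contracts_le K r M : 0 < r -> convex_in K -> contracts M ->
  (Vol (minkowski_sum ((fun x => x *m M) @` K) (dilate r unit_ball)) <=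
   Vol (minkowski_sum K (dilate r unit_ball)))%E.
Proof.
(* The set is generalised because the second factor of a product acts on the image of [K] under the
   first. *)
move=> r0 cK cM; move: M cM K cK.
apply: contraction_ind => [u c c0 cu K cK|M N PM PN K cK].
  exact: Vol_squeeze_le.
rewrite (_ : _ @` K = (fun x => x *m N) @` ((fun x => x *m M) @` K)).
  by apply: le_trans (PM _ cK); apply: PN; exact: convex_in_image.
rewrite image_comp; congr (_ @` K); apply/funext => x /=.
by rewrite mulmxA.
Qed.

End convex_sets.

(** * From linear to affine contractions *)

Theorem corollary2p7 (R : realType) (d : nat) (K : set 'rV[R]_d) (r : R)
    (T : 'rV[R]_d -> 'rV[R]_d) :
  convex_body K -> 0 < r -> affine_contraction T ->
  (Vol (minkowski_sum (T @` K) (dilate r unit_ball)) <=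
   Vol (minkowski_sum K (dilate r unit_ball)))%E.
Proof.
move=> [_ _ convK] r0 [[A [b TE]] cT].
have cK : convex_in K.
  move=> x y t /andP[t0 t1] Kx Ky.
  by have := convK x y (Itv01 t0 t1) (mem_set Kx) (mem_set Ky); rewrite inE.
pose M := lin1_mx A.
have AE x : A x = x *m M by rewrite mul_rV_lin1.
have cM : contracts M.
  move=> x; have := cT x 0; rewrite !TE opprD addrACA subrr addr0 linear0 !subr0
    !enorm_dot AE.
  by rewrite ler_sqrt// dot_ge0.
apply: le_trans (Vol_contracts_le _ _ _ r0 cK cM).
rewrite -[leRHS](Vol_translate _ (- b)); last exact: borel_row_minkowski_ball.
rewrite (_ : minkowski_sum (T @` K) _ = [set x | minkowski_sum
  ((fun x => x *m M) @` K) (dilate r unit_ball) (x - b)])//.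
apply/seteqP; split => x /=.
  move=> /(minkowski_ballP _ _ _ r0)[_ [z [[y Ky <-] zz ->]]].
  apply/minkowski_ballP => //; exists (y *m M), z; split => //; first by exists y.
  by rewrite TE AE addrAC addrK.
move=> /(minkowski_ballP _ _ _ r0)[_ [z [[y Ky <-] zz xb]]].
apply/minkowski_ballP => //; exists (T y), z; split => //.
by rewrite TE AE addrAC -xb subrK.
Qed.
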